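(* Let $\Theta=\{\theta_1,\ldots,\theta_n\}$ with $n\ge 2$, let $k\ge 2$, and let $\mathbf{M}=[a_{ij}]$, $1\le i\le k$, $1\le j\le n$, be the mass matrix of $k$ Bayesian sources $m_1,\ldots,m_k$ on $\Theta$, i.e. $a_{ij}=m_i(\theta_j)\ge 0$ and $\sum_{j=1}^n a_{ij}=1$ for each $i$, all other masses being zero. Suppose that each column of $\mathbf{M}$ contains at least one zero. Then: (1) Dempster's rule of combination (under Shafer's model) cannot be applied to $m_1,\ldots,m_k$: the degree of conflict is $1$, and for every $1\le j\le n$ both the numerator and the denominator of the expression for $m(\theta_j)$ in Dempster's rule are $0$, so that $m(\theta_j)=0/0$ is undefined. (2) The classical DSm rule (free-DSm model) gives $m(\theta_j)=0$ for all $1\le j\le n$, and for every $w$ with $2\le w\le k$ and every set $V=\{v_1,\ldots,v_w\}$ of $w$ distinct indices in $\{1,\ldots,n\}$, $$m(\theta_{v_1}\cap\theta_{v_2}\cap\cdots\cap\theta_{v_w})=\sum_{(t_1,\ldots,t_k)} a_{1t_1}a_{2t_2}\cdots a_{kt_k},$$ where the sum runs over all $k$-tuples $(t_1,\ldots,t_k)$ of indices with $\{t_1,\ldots,t_k\}=V$ as sets (one entry is taken from each row, and at least one entry is taken from each of the columns $v_1,\ldots,v_w$).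
   Context: Under Shafer's model, $\theta_1,\ldots,\theta_n$ are exclusive and exhaustive, and $2^\Theta$ is the set of all subsets of $\Theta$, with $\theta_i$ identified with $\{\theta_i\}$. A basic belief assignment (bba) on $2^\Theta$ is a map $m:2^\Theta\to[0,1]$ with $m(\emptyset)=0$ and $\sum_{A\in 2^\Theta}m(A)=1$. A source is Bayesian if its mass is supported on singletons $\theta_i$. Dempster's rule for $k$ sources: $m(\emptyset)=0$ and, for $B\in 2^\Theta$, $B\ne\emptyset$, $$m(B)=\frac{\sum_{X_1\cap\cdots\cap X_k=B}\prod_{i=1}^k m_i(X_i)}{1-\sum_{X_1\cap\cdots\cap X_k=\emptyset}\prod_{i=1}^k m_i(X_i)},$$ where the sums are over $X_1,\ldots,X_k\in 2^\Theta$. The degree of conflict is $\sum_{X_1\cap\cdots\cap X_k=\emptyset}\prod_{i=1}^k m_i(X_i)$. Free-DSm model: the hyper-power set $D^\Theta$ is the free Boolean pre-algebra (free distributive lattice, with $\emptyset$ adjoined) generated by $\theta_1,\ldots,\theta_n$ with the operations $\cup$ and $\cap$. That is, it contains $\emptyset,\theta_1,\ldots,\theta_n$, is closed under $\cup$ and $\cap$, and contains nothing else; no exclusivity between the $\theta_i$ is assumed, and in particular intersections of distinct nonempty sets of generators are distinct nonempty elements. A bba on $D^\Theta$ is a map $m:D^\Theta\to[0,1]$ with $m(\emptyset)=0$ and $\sum_{A\in D^\Theta}m(A)=1$. The classical DSm rule combines bbas $m_1,\ldots,m_k$ on $D^\Theta$ into $$m(A)=\sum_{X_1,\ldots,X_k\in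 D^\Theta,\ X_1\cap\cdots\cap X_k=A}\ \prod_{i=1}^k m_i(X_i),\qquad m(\emptyset)=0.$$ *)

(* Defs.v *)
From mathcomp Require Import all_boot all_order all_algebra.

Set Implicit Arguments.
Unset Strict Implicit.
Unset Printing Implicit Defensive.

Import Order.TTheory GRing.Theory Num.Theory.
Local Open Scope ring_scope.

(* The frame Theta is 'I_n, its power set 2^Theta is {set 'I_n}, and theta_j
   is identified with [set j] there. *)

(** * The hyper-power set D^Theta

   D^Theta is realized on the Venn diagram of n sets in general position: its
   atoms ("parts") are the nonempty subsets P of 'I_n, the part P being the
   region that lies inside theta_i exactly for i in P.  D^Theta is the least
   family of unions of parts that contains the empty set and the generators
   and is closed under union and intersection.  [hyper_free] below shows that
   this family is the free distributive lattice with bottom on theta_1, ...,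
   theta_n. *)

Definition part (n : nat) := {P : {set 'I_n} | P != set0}.

Definition theta_parts (n : nat) (j : 'I_n) : {set part n} :=
  [set P : part n | j \in val P].

Definition hyper_closed (n : nat) (F : {set {set part n}}) : bool :=
  [&& set0 \in F, [forall j : 'I_n, theta_parts j \in F] &
      [forall A in F, forall B in F, (A :|: B \in F) && (A :&: B \in F)]].

Definition hyperpower (n : nat) : {set {set part n}} :=
  \bigcap_(F : {set {set part n}} | hyper_closed F) F.

Definition hyper (n : nat) := {A : {set part n} | A \in hyperpower n}.

Lemma hyperpower_closed (n : nat) : hyper_closed (hyperpower n).
Proof.
apply/and3P; split.
- by apply/bigcapP => F /and3P[].
- by apply/forallP => j; apply/bigcapP => F /and3P[_ /forallP].
apply/'forall_in_forall_inP => A /bigcapP HA B /bigcapP HB.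
apply/andP; split; apply/bigcapP => F HF.
all: have /and3P[_ _ /'forall_in_forall_inP H] := HF.
all: by have /andP[] := H A (HA F HF) B (HB F HF).
Qed.

Lemma hyperpower0 (n : nat) : set0 \in hyperpower n.
Proof. by case/and3P: (hyperpower_closed n). Qed.

Lemma hyperpower_theta (n : nat) (j : 'I_n) : theta_parts j \in hyperpower n.
Proof. by case/and3P: (hyperpower_closed n) => _ /forallP. Qed.

Lemma hyperpowerU (n : nat) (A B : {set part n}) :
  A \in hyperpower n -> B \in hyperpower n -> A :|: B \in hyperpower n.
Proof.
move=> HA HB; case/and3P: (hyperpower_closed n) => _ _.
by move/'forall_in_forall_inP => /(_ A HA B HB) /andP[].
Qed.

Lemma hyperpowerI (n : nat) (A B : {set part n}) :
  A \in hyperpower n -> B \in hyperpower n -> A :&: B \in hyperpower n.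
Proof.
move=> HA HB; case/and3P: (hyperpower_closed n) => _ _.
by move/'forall_in_forall_inP => /(_ A HA B HB) /andP[].
Qed.

Lemma hyperpowerT (n : nat) : setT \in hyperpower n.
Proof.
have -> : [set: part n] = \bigcup_(j : 'I_n) theta_parts j.
  apply/setP => P; rewrite inE; apply/esym/bigcupP.
  by have /set0Pn[j jP] := valP P; exists j; rewrite ?inE.
apply: (big_ind (fun A => A \in hyperpower n)).
- exact: hyperpower0.
- exact: hyperpowerU.
- by move=> j _; exact: hyperpower_theta.
Qed.

Definition theta (n : nat) (j : 'I_n) : hyper n :=
  exist _ (theta_parts j) (hyperpower_theta j).
Definition hempty (n : nat) : hyper n := exist _ set0 (hyperpower0 n).
(* The total ignorance theta_1 \/ ... \/ theta_n; it is the neutral element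
   of [hcap], hence the index of the iterated intersections. *)
Definition htotal (n : nat) : hyper n := exist _ setT (hyperpowerT n).
Definition hcup (n : nat) (A B : hyper n) : hyper n :=
  exist _ (val A :|: val B) (hyperpowerU (valP A) (valP B)).
Definition hcap (n : nat) (A B : hyper n) : hyper n :=
  exist _ (val A :&: val B) (hyperpowerI (valP A) (valP B)).

Definition hyper_morphism (n : nat) (d : Order.disp_t)
    (L : bDistrLatticeType d) (f : 'I_n -> L) (h : hyper n -> L) : Prop :=
  [/\ h (hempty n) = (\bot)%O,
      forall j, h (theta j) = f j,
      forall A B, h (hcup A B) = (h A `|` h B)%O &
      forall A B, h (hcap A B) = (h A `&` h B)%O].

Section Free.
Variables (n : nat) (d : Order.disp_t) (L : bDistrLatticeType d).
Variable f : 'I_n -> L.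

Let m0 (P : part n) : L :=
  if [pick i in val P] is Some i then f i else (\bot)%O.
Let g (P : part n) : L := (\big[Order.meet/m0 P]_(i in val P) f i)%O.

Let le_g (x : L) (P : part n) :
  reflect (forall i, i \in val P -> (x <= f i)%O) (x <= g P)%O.
Proof.
apply: (iffP idP) => [xg i iP | H].
  apply: le_trans xg _; rewrite /g.
  have : i \in index_enum 'I_n by rewrite mem_index_enum.
  elim: (index_enum _) => // k s IHs; rewrite inE big_cons.
  case/orP=> [/eqP <-|/IHs IH]; first by rewrite iP leIl.
  by case: ifP => // _; apply: le_trans IH; apply: leIr.
rewrite /g; apply: (big_ind (fun y => x <= y)%O) => //.
- rewrite /m0; case: pickP => [i /H //|P0].
  by have /set0Pn[i] := valP P; rewrite P0.
- by move=> y z xy xz; rewrite lexI xy xz.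
Qed.

Let h (A : hyper n) : L := (\join_(P in val A) g P)%O.

Let upset (A : {set part n}) :=
  [forall P in A, forall Q : part n, (val P \subset val Q) ==> (Q \in A)].

Let hyper_upset (A : hyper n) (P Q : part n) :
  P \in val A -> val P \subset val Q -> Q \in val A.
Proof.
suff /bigcapP/(_ [set B | upset B]) : val A \in hyperpower n.
  rewrite inE => H PA PQ.
  have /forall_inP/(_ P PA)/forallP/(_ Q)/implyP : upset (val A).
    apply: H; apply/and3P; split.
    - by rewrite inE; apply/forall_inP => ?; rewrite inE.
    - apply/forallP => j; rewrite inE; apply/forall_inP => S; rewrite inE => jS.
      by apply/forallP => T; apply/implyP => /subsetP ST; rewrite inE ST.
    - apply/'forall_in_forall_inP => B + C +; rewrite !inE => /forall_inP HB /forall_inP HC.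
      apply/andP; split; apply/forall_inP => S; rewrite !inE.
        case/orP=> [/HB|/HC] /forallP HS; apply/forallP => T; apply/implyP => ST;
        by rewrite inE (implyP (HS T) ST) ?orbT.
      case/andP=> /HB/forallP H1 /HC/forallP H2.
      apply/forallP => T; apply/implyP => ST.
      by rewrite inE (implyP (H1 T) ST) (implyP (H2 T) ST).
  exact.
exact: valP.
Qed.

Lemma hyper_free : exists2 h : hyper n -> L, hyper_morphism f h &
  forall h', hyper_morphism f h' -> h' =1 h.
Proof.
have hM : hyper_morphism f h.
  split.
  - by rewrite /h big_pred0 // => P; rewrite inE.
  - move=> j; apply/le_anti/andP; split.
      apply/joinsP => P; rewrite inE => jP.
      by move: (lexx (g P)) => /le_g; apply.
    have j1 : [set j] != set0 by apply/set0Pn; exists j; rewrite inE.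
    apply: (@joins_min _ _ _ (exist _ [set j] j1 : part n)); rewrite ?inE //.
    by apply/le_g => i; rewrite inE => /eqP ->.
  - move=> A B; rewrite /h; apply/le_anti/andP; split.
      apply/joinsP => P; rewrite inE => /orP[PA|PB].
        by apply: lexUl; apply: (@joins_min _ _ _ P).
      by apply: lexUr; apply: (@joins_min _ _ _ P).
    rewrite leUx; apply/andP; split; apply/joinsP => P PX;
    by apply: (@joins_min _ _ _ P); rewrite //= inE PX ?orbT.
  - move=> A B; rewrite /h; apply/le_anti/andP; split.
      apply/joinsP => P; rewrite inE => /andP[PA PB].
      by rewrite lexI; apply/andP; split; apply: (@joins_min _ _ _ P).
    set y := (X in (_ `&` X <= _)%O).
    rewrite (big_endo (fun x => x `&` y)%O (fun _ _ => meetUl _ _ _) (meet0x _)).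
    apply/joinsP => P PA; rewrite /y.
    rewrite (big_endo (fun x => g P `&` x)%O (meetUr _) (meetx0 _)).
    apply/joinsP => Q QB.
    have PQ0 : val P :|: val Q != set0.
      by have /set0Pn[i iP] := valP P; apply/set0Pn; exists i; rewrite inE iP.
    pose PQ : part n := exist (fun S : {set _} => S != set0) _ PQ0.
    apply: (@joins_min _ _ _ PQ).
      rewrite inE (hyper_upset PA) ?subsetUl //=.
      by rewrite (hyper_upset QB) // subsetUr.
    apply/le_g => i; rewrite inE => /orP[iP|iQ].
      by apply: leIxl; move: (lexx (g P)) => /le_g ->.
    by apply: leIxr; move: (lexx (g Q)) => /le_g ->.
exists h => // h' [h'0 h'g h'U h'I] A.
case: hM => h0 hg hU hI.
pose F := [set val a | a : hyper n & h' a == h a].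
have FC : hyper_closed F.
  apply/and3P; split.
  - by apply/imsetP; exists (hempty n); rewrite ?inE ?h0 ?h'0.
  - by apply/forallP => j; apply/imsetP; exists (theta j); rewrite ?inE ?hg ?h'g.
  - apply/'forall_in_forall_inP => _ /imsetP[a + ->] _ /imsetP[b + ->].
    rewrite !inE => /eqP ea /eqP eb; apply/andP; split; apply/imsetP.
      by exists (hcup a b); rewrite ?inE ?hU ?h'U ?ea ?eb.
    by exists (hcap a b); rewrite ?inE ?hI ?h'I ?ea ?eb.
have /bigcapP/(_ F FC)/imsetP[a + /val_inj ->] := valP A.
by rewrite inE => /eqP.
Qed.
End Free.

(** * Basic belief assignments and rules of combination *)

Section Belief.
Variable R : realFieldType.

(* [e] is the empty proposition of T, with T either 2^Theta or D^Theta. *)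
Definition is_bba (T : finType) (e : T) (m : {ffun T -> R}) : Prop :=
  [/\ forall A, 0 <= m A <= 1, m e = 0 & \sum_A m A = 1].

(* m_1, ..., m_k are Bayesian bbas with mass matrix M; [s j] is the singleton
   theta_j of T. *)
Definition bayesian_sources (T : finType) (e : T) (n k : nat) (s : 'I_n -> T)
    (M : 'M[R]_(k, n)) (m : 'I_k -> {ffun T -> R}) : Prop :=
  forall i, [/\ is_bba e (m i), forall j, m i (s j) = M i j &
                forall A, (forall j, A <> s j) -> m i A = 0].

(* The sum of prod_i m_i(X_i) over X_1 /\ ... /\ X_k = A. *)
Definition conj_mass (T : finType) (cap : T -> T -> T) (top : T) (k : nat)
    (m : 'I_k -> {ffun T -> R}) (A : T) : R :=
  \sum_(X : {ffun 'I_k -> T} | \big[cap/top]_(i < k) X i == A)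
    \prod_(i < k) m i (X i).

Definition dempster_num (n k : nat) (m : 'I_k -> {ffun {set 'I_n} -> R})
    (B : {set 'I_n}) : R := conj_mass (@setI _) setT m B.

Definition conflict (n k : nat) (m : 'I_k -> {ffun {set 'I_n} -> R}) : R :=
  conj_mass (@setI _) setT m set0.

Definition dempster_den (n k : nat) (m : 'I_k -> {ffun {set 'I_n} -> R}) : R :=
  1 - conflict m.

(* Division is total in R, so the partiality of Dempster's rule is made
   explicit: the rule is undefined when its denominator vanishes. *)
Definition dempster (n k : nat) (m : 'I_k -> {ffun {set 'I_n} -> R}) :
    option {ffun {set 'I_n} -> R} :=
  if dempster_den m == 0 then None
  else Some [ffun B => if B == set0 then 0
                       else dempster_num m B / dempster_den m].

Definition dsm (n k : nat) (m : 'I_k -> {ffun hyper n -> R}) :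
    {ffun hyper n -> R} :=
  [ffun A => if A == hempty n then 0 else conj_mass (@hcap n) (htotal n) m A].

End Belief.

(* Main.v *)
Require Import Defs.
From mathcomp Require Import all_boot all_order all_algebra.

Set Implicit Arguments.
Unset Strict Implicit.
Unset Printing Implicit Defensive.

Import Order.TTheory GRing.Theory Num.Theory.
Local Open Scope ring_scope.

(** For Bayesian sources both rules reduce to sums over the tuples
    (t_1, ..., t_k) of generators picked in the rows of M.  A tuple has a nonempty
    intersection in [2^Theta] only if it is constant, and then its product
    contains a zero of the corresponding column; hence all the mass goes to the
    empty set.  In [D^Theta] an intersection of generators determines the set of
    these generators, because the part V belongs to the intersection of the
    [theta v], [v \in W], exactly when W is a subset of V. *)

(** A family X with some X_i outside the generators has a zero factor. By injectivity of [s], the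
    other families correspond one-to-one to tuples of indices, through [h] below. *)
Lemma conj_mass_bayesian (R : realFieldType) (T : finType) (e : T)
    (cap : T -> T -> T) (top : T) (n k : nat) (s : 'I_n -> T) (M : 'M[R]_(k, n))
    (m : 'I_k -> {ffun T -> R}) (A : T) :
  injective s -> bayesian_sources e s M m ->
  conj_mass cap top m A =
  \sum_(t : {ffun 'I_k -> 'I_n} | \big[cap/top]_(i < k) s (t i) == A)
    \prod_(i < k) M i (t i).
Proof.
move=> s_inj Hm.
pose h (t : {ffun 'I_k -> 'I_n}) := [ffun i => s (t i)].
have h_inj : injective h.
  move=> t u /ffunP tu; apply/ffunP => i; apply: s_inj.
  by move: (tu i); rewrite !ffunE.
have capE t : \big[cap/top]_(i < k) h t i = \big[cap/top]_(i < k) s (t i).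
  by apply: eq_bigr => i _; rewrite ffunE.
have m0 X : X \notin codom h -> \prod_(i < k) m i (X i) = 0.
  move=> Xh; suff [i Xi] : exists i, X i \notin codom s.
    have [_ _ mi0] := Hm i.
    rewrite (bigD1 i) //= mi0 ?mul0r // => j Xij.
    by rewrite Xij codom_f in Xi.
  apply/existsP; apply: contraR Xh; rewrite negb_exists => /forallP Xs.
  have Xs' i : X i \in codom s by apply/negPn.
  apply/codomP; exists [ffun i => iinv (Xs' i)]; apply/ffunP => i.
  by rewrite !ffunE f_iinv.
rewrite /conj_mass (bigID [in codom h]) /= [X in _ + X]big1 ?addr0; last first.
  by move=> X /andP[_ /m0].
(* Since [h] is injective, its codomain lists each family once, so the sum can be reindexed by
   tuples. *)
rewrite big_mkcondl /= -big_uniq /=; last exact/injectiveP.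
rewrite big_image /= [RHS]big_mkcond /=.
apply: eq_bigr => t _; rewrite capE; case: ifP => // _.
by apply: eq_bigr => i _; rewrite ffunE; have [_ -> _] := Hm i.
Qed.

Lemma prod_const_col0 (R : realFieldType) (n k : nat) (M : 'M[R]_(k, n))
    (t : {ffun 'I_k -> 'I_n}) (j : 'I_n) :
  (exists i, M i j = 0) -> (forall i, t i = j) -> \prod_(i < k) M i (t i) = 0.
Proof. by move=> [i Mij0] tj; rewrite (bigD1 i) //= tj Mij0 mul0r. Qed.

(** Expanding the product of the k row sums gives one term per tuple. *)
Lemma sum_prod_stochastic (R : realFieldType) (n k : nat) (M : 'M[R]_(k, n)) :
  (forall i, \sum_(j < n) M i j = 1) ->
  \sum_(t : {ffun 'I_k -> 'I_n}) \prod_(i < k) M i (t i) = 1.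
Proof.
by move=> M1; rewrite -(bigA_distr_bigA (fun i j => M i j)) /= big1.
Qed.

Lemma mem_bigcap_theta (n : nat) (V : {set 'I_n}) (P : part n) :
  (P \in val (\big[@hcap n/htotal n]_(v in V) theta v)) = (V \subset val P).
Proof.
rewrite (big_morph val (id1 := setT) (op1 := @setI _)) //=.
apply/bigcapP/subsetP => VP v /VP; by rewrite inE.
Qed.

(** Repeated generators do not change an intersection, so a tuple matters only through its image. *)
Lemma bigcap_theta_imset (n k : nat) (t : 'I_k -> 'I_n) :
  \big[@hcap n/htotal n]_(i < k) theta (t i) =
  \big[@hcap n/htotal n]_(v in [set t i | i : 'I_k]) theta v.
Proof.
apply/val_inj/setP => P; rewrite mem_bigcap_theta.
rewrite (big_morph val (id1 := setT) (op1 := @setI _)) //=.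
apply/bigcapP/subsetP => [tP _ /imsetP[i _ ->]|tP i _].
  by have := tP i isT; rewrite inE.
by rewrite inE tP ?imset_f.
Qed.

(** Being nonempty, V and W are themselves parts; testing the common intersection on each of them
    gives both inclusions. *)
Lemma bigcap_theta_inj (n : nat) :
  {in [pred V : {set 'I_n} | V != set0] &,
    injective (fun V : {set 'I_n} => \big[@hcap n/htotal n]_(v in V) theta v)}.
Proof.
move=> V W V0 W0 /(congr1 val)/setP VW; apply/eqP; rewrite eqEsubset.
have := VW (exist _ V V0); have := VW (exist _ W W0).
by rewrite !mem_bigcap_theta /= !subxx => -> <-.
Qed.

(** This makes single generators an instance of the results on intersections. *)
Lemma theta_bigcap1 (n : nat) (j : 'I_n) :
  theta j = \big[@hcap n/htotal n]_(v in [set j]) theta v.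
Proof.
by apply/val_inj/setP => P; rewrite mem_bigcap_theta sub1set inE.
Qed.

Lemma theta_inj (n : nat) : injective (@theta n).
Proof.
move=> i j; rewrite (theta_bigcap1 i) (theta_bigcap1 j).
have set1_neq0 l : [set l] \in [pred V : {set 'I_n} | V != set0].
  by rewrite inE; apply/set0Pn; exists l; rewrite inE.
by move/(bigcap_theta_inj (set1_neq0 i) (set1_neq0 j))/set1_inj.
Qed.

Lemma dsm_bigcap_theta (R : realFieldType) (n k : nat) (M : 'M[R]_(k, n))
    (m : 'I_k -> {ffun hyper n -> R}) (V : {set 'I_n}) :
  (0 < k)%N -> bayesian_sources (hempty n) (@theta n) M m -> V != set0 ->
  dsm m (\big[@hcap n/htotal n]_(v in V) theta v) =
  \sum_(t : {ffun 'I_k -> 'I_n} | [set t i | i : 'I_k] == V)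
    \prod_(i < k) M i (t i).
Proof.
move=> k0 Hm V0; rewrite ffunE ifN; last first.
  (* The part V itself witnesses that the intersection is not empty. *)
  apply/eqP => /(congr1 val)/setP/(_ (exist _ V V0)).
  by rewrite mem_bigcap_theta subxx inE.
rewrite (conj_mass_bayesian _ _ _ (@theta_inj n) Hm); apply: eq_bigl => t.
rewrite bigcap_theta_imset (inj_in_eq (@bigcap_theta_inj n)) //.
(* As k > 0, the image of t is nonempty, as injectivity requires. *)
by apply/set0Pn; exists (t (Ordinal k0)); apply: imset_f.
Qed.

Theorem mainTheorem1 (R : realFieldType) (n k : nat) (hn : (2 <= n)%N)
    (hk : (2 <= k)%N) (M : 'M[R]_(k, n))
    (M_ge0 : forall i j, 0 <= M i j)
    (M_sum1 : forall i, \sum_(j < n) M i j = 1)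
    (M_col0 : forall j, exists i, M i j = 0)
    (mS : 'I_k -> {ffun {set 'I_n} -> R})
    (HmS : bayesian_sources set0 (fun j : 'I_n => [set j]) M mS)
    (mD : 'I_k -> {ffun hyper n -> R})
    (HmD : bayesian_sources (hempty n) (@theta n) M mD) :
  [/\ conflict mS = 1,
      forall j : 'I_n, dempster_num mS [set j] = 0 /\ dempster_den mS = 0
    & dempster mS = None]
  /\
  ((forall j : 'I_n, dsm mD (theta j) = 0) /\
   (forall w : nat, (2 <= w <= k)%N ->
    forall V : {set 'I_n}, #|V| = w ->
      dsm mD (\big[@hcap n/htotal n]_(v in V) theta v) =
      \sum_(t : {ffun 'I_k -> 'I_n} | [set t i | i : 'I_k] == V)
        \prod_(i < k) M i (t i))).
Proof.
have k0 : (0 < k)%N := ltnW hk.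
have capS (t : {ffun 'I_k -> 'I_n}) j :
    j \in \bigcap_(i < k) [set t i] -> forall i, t i = j.
  by move/bigcapP => tj i; have := tj i isT; rewrite inE => /eqP.
have conflict1 : conflict mS = 1.
  rewrite /conflict (conj_mass_bayesian _ _ _ (@set1_inj _) HmS).
  rewrite -[RHS](sum_prod_stochastic M_sum1).
  (* The total 1 over all tuples splits into the conflict and the constant tuples, whose products
     vanish. *)
  rewrite [RHS](bigID (fun t : {ffun _} => \bigcap_(i < k) [set t i] == set0)) /=.
  rewrite [X in _ = _ + X]big1 ?addr0 // => t /set0Pn[j /capS].
  exact: prod_const_col0.
have den0 : dempster_den mS = 0 by rewrite /dempster_den conflict1 subrr.
split; split.
- by [].
- move=> j; split=> //.
  rewrite /dempster_num (conj_mass_bayesian _ _ _ (@set1_inj _) HmS).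
  apply: big1 => t /eqP tj; apply: (prod_const_col0 (M_col0 j)).
  by apply: capS; rewrite tj inE.
- by rewrite /dempster den0 eqxx.
(* For V = {j}, the only tuple with image V is the constant one. *)
- move=> j; rewrite theta_bigcap1 (dsm_bigcap_theta k0 HmD); last first.
    by apply/set0Pn; exists j; rewrite inE.
  apply: big1 => t /eqP tj; apply: (prod_const_col0 (M_col0 j)) => i.
  by apply/set1P; rewrite -tj imset_f.
- move=> w /andP[w2 _] V Vw.
  by apply: dsm_bigcap_theta => //; rewrite -card_gt0 Vw ltnW.
Qed.
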